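(* For every $d$-degenerate finite simple graph $G$, $\mathrm{HG_{lin}}(G)\le d+1$; that is, every prime power $q$ for which $G$ is linearly $q$-solvable satisfies $q\le d+1$.
   Context: A graph $G$ on $n$ vertices is $d$-degenerate if there is an ordering $v_{1},\ldots,v_{n}$ of its vertices such that for every $2\le j\le n$, $v_{j}$ is adjacent to at most $d$ vertices among $v_{1},\ldots,v_{j-1}$. Let $q$ be a prime power, and let the set of colors be the finite field $\mathbb{F}_q$. A coloring is any $x\in\mathbb{F}_q^n$, where $x_i$ is the color of $v_i$. A linear guessing strategy over $\mathbb{F}_q$ is a choice, for each $i$, of an affine function $f_i(x)=\sum_{j\in N_i}a_{i,j}x_j+b_i$ with $a_{i,j},b_i\in\mathbb{F}_q$, where $N_i$ is the set of indices of the neighbors of $v_i$; vertex $v_i$ guesses correctly on $x$ if $f_i(x)=x_i$. $G$ is linearly $q$-solvable if there is a linear guessing strategy over $\mathbb{F}_q$ such that for every $x\in\mathbb{F}_q^n$ at least one vertex guesses correctly. The linear hat guessing number $\mathrm{HG_{lin}}(G)$ is the largest prime power $q$ for which $G$ is linearly $q$-solvable. *)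

(* Defs.v *)
From HB Require Import structures.
From mathcomp Require Import all_boot all_order all_algebra.

Set Implicit Arguments.
Unset Strict Implicit.
Unset Printing Implicit Defensive.

Import GRing.Theory.
Local Open Scope ring_scope.

Record sgraph := SGraph {
  vertex :> finType;
  adj : rel vertex;
  adj_sym : symmetric adj;
  adj_irrefl : irreflexive adj }.

(* The ordering v_1, ..., v_n is a bijection v from 'I_n, shifted to start at
   index 0; its first vertex satisfies the bound trivially. *)
Definition degenerate (d : nat) (G : sgraph) : Prop :=
  exists v : 'I_#|G| -> G, bijective v /\
    forall j : 'I_#|G|,
      (#|[set i : 'I_#|G| | (i < j)%N && adj (v i) (v j)]| <= d)%N.

Definition coloring (F : finFieldType) (G : sgraph) := {ffun G -> F}.

(* Only the coefficients a i j with i and j adjacent are used. *)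
Record lin_strategy (F : finFieldType) (G : sgraph) := LinStrategy {
  coef : G -> G -> F;
  offset : G -> F }.

Definition guess (F : finFieldType) (G : sgraph) (f : lin_strategy F G)
    (i : G) (x : coloring F G) : F :=
  \sum_(j : G | adj i j) coef f i j * x j + offset f i.

Definition winning (F : finFieldType) (G : sgraph)
    (f : lin_strategy F G) : Prop :=
  forall x : coloring F G, exists i : G, guess f i x = x i.

Definition prime_power (q : nat) : Prop :=
  exists p k : nat, [/\ prime p, (0 < k)%N & q = (p ^ k)%N].

(* Finite fields of the same order are isomorphic, so any field F of order q
   may serve as F_q. *)
Definition linearly_solvable (q : nat) (G : sgraph) : Prop :=
  exists F : finFieldType, #|F| = q /\ exists f : lin_strategy F G, winning f.

(* A relation rather than a function: an edgeless graph is linearly q-solvable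
   for no q, and then no largest q exists. *)
Definition is_HG_lin (G : sgraph) (h : nat) : Prop :=
  [/\ prime_power h, linearly_solvable h G
    & forall q : nat, prime_power q -> linearly_solvable q G -> (q <= h)%N].

(* Main.v *)
Require Import Defs.
From mathcomp Require Import all_boot all_order all_algebra.

(** A strategy fails on x when none of the affine forms
      l_i(x) = x_i - (guess of vertex i on x)
    vanishes at x.  Number the vertices by a degenerate ordering, and call the
    last variable that occurs in l_i its leading variable.  Choose the colors
    x_0, x_1, ... greedily: once the earlier colors are fixed, a form with
    leading variable x_k vanishes for exactly one value of x_k, and no later
    choice affects it.  Hence a choice avoiding all zeros exists as soon as
    fewer than q forms lead in each x_k ([avoid_affine_zeros]).

    Since x_i occurs in l_i with coefficient 1, the leading variable of l_i
    comes no earlier than i.  So x_k can lead only in l_k itself and in l_i for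
    neighbors i of k that precede k: at most d + 1 forms
    ([nonwinning_of_degenerate]).  A winning strategy therefore forces
    q <= d + 1. *)

Import GRing.Theory.
Local Open Scope ring_scope.

Definition affine_value {F : finFieldType} {I : finType} {n : nat}
    (c : I -> 'I_n -> F) (b : I -> F) (x : 'I_n -> F) (i : I) : F :=
  \sum_j c i j * x j + b i.

Definition leading_rows {F : finFieldType} {I : finType} {n : nat}
    (c : I -> 'I_n -> F) (k : 'I_n) : {set I} :=
  [set i | (c i k != 0) && [forall j : 'I_n, (k < j)%N ==> (c i j == 0)]].

Lemma affine_value_shift {F : finFieldType} {I : finType} {n : nat}
    (c : I -> 'I_n -> F) (b : I -> F) (x : 'I_n -> F) (k : 'I_n) (t : F) i :
  affine_value c b (fun j => x j + (if j == k then t else 0)) i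
    = affine_value c b x i + c i k * t.
Proof.
rewrite /affine_value addrAC; congr (_ + _).
under eq_bigr => j _ do rewrite mulrDr.
rewrite big_split /=; congr (_ + _).
rewrite (bigD1 k) //= eqxx big1 ?addr0 // => j /negbTE ->.
by rewrite mulr0.
Qed.

(** The greedy choice.  Choosing a value for coordinate k settles exactly the
    forms whose leading variable is the k-th one; each of them excludes a
    single value, so some element of F remains. *)
Lemma avoid_affine_zeros {F : finFieldType} {I : finType} {n : nat}
    (c : I -> 'I_n -> F) (b : I -> F) :
  (forall i, exists j, c i j != 0) ->
  (forall k, (#|leading_rows c k| < #|F|)%N) ->
  exists x : 'I_n -> F, forall i, affine_value c b x i != 0.
Proof.
move=> row_neq0 few_leading.
(* Invariant after k choices: the forms in the first k variables are nonzero. *)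
suff greedy k : (k <= n)%N -> exists x : 'I_n -> F, forall i,
    (forall j : 'I_n, (k <= j)%N -> c i j = 0) -> affine_value c b x i != 0.
  have [x xP] := greedy n (leqnn n).
  by exists x => i; apply: xP => j; rewrite leqNgt ltn_ord.
elim: k => [_|k IHk lt_kn].
  exists (fun=> 0) => i c0; have [j] := row_neq0 i.
  by rewrite c0 ?eqxx.
have [x xP] := IHk (ltnW lt_kn).
pose u := Ordinal lt_kn.
pose root i := - affine_value c b x i / c i u.
have [t t_ok] : exists t, t \notin [set root i | i in leading_rows c u].
  apply/existsP; rewrite -negb_forall; apply/negP => /forallP all_bad.
  have := leq_ltn_trans (leq_imset_card root _) (few_leading u).
  rewrite ltnNge => /negP; apply.
  by apply/subset_leq_card/subsetP => y _; apply: all_bad.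
exists (fun j => x j + (if j == u then t else 0)) => i c_above.
rewrite affine_value_shift.
have [ciu0|ciu_neq0] := eqVneq (c i u) 0.
  rewrite ciu0 mul0r addr0; apply: xP => j.
  rewrite leq_eqVlt => /predU1P[kj|]; last exact: c_above.
  by rewrite -ciu0; congr (c i _); apply: val_inj.
apply: contraNneq t_ok => value0; apply/imsetP; exists i.
  rewrite inE ciu_neq0; apply/forallP => j; apply/implyP => lt_uj.
  by apply/eqP/c_above.
rewrite /root; apply: (mulIf ciu_neq0); rewrite divfK // mulrC.
by apply/eqP; rewrite -addr_eq0 addrC value0.
Qed.

(** In the degenerate ordering, a form l_i that leads in x_k has i = k or i an
    earlier neighbor of k, because the coefficient of x_i in l_i is 1; so the
    greedy choice finds a coloring on which every guess is wrong. *)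
Lemma nonwinning_of_degenerate {d : nat} {G : sgraph} {F : finFieldType}
    (f : lin_strategy F G) :
  degenerate d G -> (d.+1 < #|F|)%N -> ~ winning f.
Proof.
move=> [v [[rank vK rankK] back_deg]] lt_dF win.
pose c (i j : 'I_#|G|) : F :=
  (i == j)%:R - (if adj (v i) (v j) then coef f (v i) (v j) else 0).
pose b i := - offset f (v i).
have c_diag i : c i i = 1 by rewrite /c eqxx adj_irrefl subr0.
have [i|k|x xP] := avoid_affine_zeros c b.
- by exists i; rewrite c_diag oner_neq0.
- apply: leq_ltn_trans lt_dF.
  pose back := [set i : 'I_#|G| | (i < k)%N && adj (v i) (v k)].
  have sub : leading_rows c k \subset k |: back.
    apply/subsetP => i; rewrite !inE => /andP[cik_neq0 /forallP c_above].
    have [//|i_neq_k] := eqVneq i k.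
    apply/andP; split.
      rewrite ltn_neqAle i_neq_k leqNgt; apply/negP => lt_ki.
      by have := c_above i; rewrite lt_ki c_diag oner_eq0.
    apply: contraNT cik_neq0 => /negbTE nadj.
    by rewrite /c (negbTE i_neq_k) nadj subr0.
  apply: leq_trans (subset_leq_card sub) _.
  rewrite cardsU1; apply: (leq_add (leq_b1 _)); exact: back_deg.
have [w guess_w] := win [ffun w => x (rank w)].
have /negP := xP (rank w); apply; apply/eqP.
rewrite /affine_value /b /c rankK.
under eq_bigr => j _ do rewrite mulrBl.
rewrite sumrB (bigD1 (rank w)) //= eqxx mul1r big1 ?addr0; last first.
  by move=> j; rewrite eq_sym => /negbTE ->; rewrite mul0r.
move: guess_w; rewrite /guess ffunE => <-.
rewrite (reindex v) /=; last by exists rank => ? _.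
rewrite big_mkcond /=.
set s1 := \sum_(i < _) _; set s2 := \sum_(i < _) _.
suff -> : s1 = s2 by rewrite addrAC addrK subrr.
apply: eq_bigr => j _; rewrite ffunE vK.
by case: ifP; rewrite ?mul0r.
Qed.

Theorem theorem1p12 (d : nat) (G : sgraph) (hG : degenerate d G) :
  (forall q : nat, prime_power q -> linearly_solvable q G -> (q <= d + 1)%N) /\
  (forall h : nat, is_HG_lin G h -> (h <= d + 1)%N).
Proof.
have bound q : linearly_solvable q G -> (q <= d + 1)%N.
  move=> [F [<- [f win]]]; rewrite addn1 leqNgt; apply/negP => lt_dF.
  exact: nonwinning_of_degenerate hG lt_dF win.
by split=> [q _|h [_ h_solvable _]]; exact: bound.
Qed.
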